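(* Let $\mathbb{T}$ be a time scale, $a,b\in\mathbb{T}$ with $a<b$, $\alpha\in[0,1]$, and $p>1$. For continuous functions $f,g:[a,b]_{\mathbb{T}}\to\mathbb{R}$ we have $$\left(\int_a^b|(f+g)(x)|^p\Diamond_\alpha x\right)^{\frac1p}\le\left(\int_a^b|f(x)|^p\Diamond_\alpha x\right)^{\frac1p}+\left(\int_a^b|g(x)|^p\Diamond_\alpha x\right)^{\frac1p}.$$
   Context: A time scale is a nonempty closed subset of $\mathbb{R}$; $[a,b]_{\mathbb{T}}=[a,b]\cap\mathbb{T}$; $\sigma(t)=\inf\{s\in\mathbb{T}:s>t\}$, $\rho(t)=\sup\{s\in\mathbb{T}:s<t\}$. The $\Delta$-derivative $f^\Delta(t)$ satisfies: for each $\varepsilon>0$, $|f(\sigma(t))-f(s)-f^\Delta(t)(\sigma(t)-s)|\le\varepsilon|\sigma(t)-s|$ for $s$ near $t$; the $\nabla$-derivative is defined likewise with $\rho$ in place of $\sigma$. $\int_a^bf\Delta t=F(b)-F(a)$ with $F^\Delta=f$, and $\int_a^bf\nabla t=H(b)-H(a)$ with $H^\nabla=f$. For $0\le\alpha\le1$ the $\Diamond_\alpha$-integral is $\int_a^bf(s)\Diamond_\alpha s=\alpha\int_a^bf(s)\Delta s+(1-\alpha)\int_a^bf(s)\nabla s$. *)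

(* Defs.v *)
From HB Require Import structures.
From mathcomp Require Import all_boot all_order all_algebra.
From mathcomp Require Import all_classical all_reals all_analysis.

Set Implicit Arguments.
Unset Strict Implicit.
Unset Printing Implicit Defensive.

Import Order.TTheory GRing.Theory Num.Theory.
Import numFieldNormedType.Exports.
Local Open Scope classical_set_scope.
Local Open Scope ring_scope.

Definition time_scale (R : realType) (T : set R) : Prop :=
  T !=set0 /\ closed T.

Definition ts_itv (R : realType) (T : set R) (a b : R) : set R :=
  [set t | a <= t <= b] `&` T.

(* With the usual conventions sigma (max T) = max T and rho (min T) = min T
   (inf and sup of the empty set are 0 in the library). *)
Definition sigma (R : realType) (T : set R) (t : R) : R :=
  let U := [set s | T s /\ t < s] in if U == set0 then t else inf U.

Definition rho (R : realType) (T : set R) (t : R) : R :=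
  let U := [set s | T s /\ s < t] in if U == set0 then t else sup U.

(* [is_delta_derive T F t d] means F^Delta(t) = d. At a left-scattered maximum
   of T, where the Delta-derivative is not defined, it holds for every d, so
   that such a point imposes no condition on antiderivatives. Likewise for the
   nabla-derivative at a right-scattered minimum. *)
Definition is_delta_derive (R : realType) (T : set R) (F : R -> R) (t d : R)
    : Prop :=
  forall e : R, 0 < e ->
    \forall s \near within T (nbhs t),
      `|F (sigma T t) - F s - d * (sigma T t - s)| <= e * `|sigma T t - s|.

Definition is_nabla_derive (R : realType) (T : set R) (F : R -> R) (t d : R)
    : Prop :=
  forall e : R, 0 < e ->
    \forall s \near within T (nbhs t),
      `|F (rho T t) - F s - d * (rho T t - s)| <= e * `|rho T t - s|.

(* The integrals below are for a <= b in T. Integrands only matter on [a, b]_T,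
   whereas antiderivatives are functions on the whole of T (in particular the
   Delta-derivative at b involves F (sigma T b)); their values off T are
   irrelevant. The integral is 0 by convention if there is no
   antiderivative. *)
Definition delta_antiderivative (R : realType) (T : set R) (a b : R)
    (f F : R -> R) : Prop :=
  forall t, ts_itv T a b t -> is_delta_derive T F t (f t).

Definition nabla_antiderivative (R : realType) (T : set R) (a b : R)
    (f H : R -> R) : Prop :=
  forall t, ts_itv T a b t -> is_nabla_derive T H t (f t).

Definition delta_integral (R : realType) (T : set R) (a b : R) (f : R -> R)
    : R :=
  let F := xget (fun=> 0) [set F | delta_antiderivative T a b f F] in
  F b - F a.

Definition nabla_integral (R : realType) (T : set R) (a b : R) (f : R -> R)
    : R :=
  let H := xget (fun=> 0) [set H | nabla_antiderivative T a b f H] in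
  H b - H a.

Definition diamond_integral (R : realType) (T : set R) (alpha a b : R)
    (f : R -> R) : R :=
  alpha * delta_integral T a b f + (1 - alpha) * nabla_integral T a b f.

(* Main.v *)
Require Import Defs.
From HB Require Import structures.
From mathcomp Require Import all_boot all_order all_algebra.
From mathcomp Require Import all_classical all_reals all_analysis.
From mathcomp Require Import measurable_realfun.
From mathcomp Require Import ring lra.

Set Implicit Arguments.
Unset Strict Implicit.
Unset Printing Implicit Defensive.

Import Order.TTheory GRing.Theory Num.Theory.
Import numFieldNormedType.Exports.
Local Open Scope classical_set_scope.
Local Open Scope ring_scope.

(** The Diamond-alpha integral of a time scale is a positive linear functional on
    the continuous functions on [a, b]_T, and Minkowski's inequality holds for
    every such functional I. Indeed, let A = I(|f|^p)^(1/p) and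
    B = I(|g|^p)^(1/p), both positive for simplicity. Writing f + g as A + B
    times a convex combination of f / A and g / B with weights A / (A + B) and
    B / (A + B), convexity of y |-> y^p gives, at each point,
    |f + g|^p <= (A + B)^p (A / (A + B) |f / A|^p + B / (A + B) |g / B|^p)
    ([powR_normD_le]). Applying I, the right-hand side becomes (A + B)^p. To
    allow A = 0 or B = 0, both are first enlarged by a small amount
    ([minkowski_of_weights]).

    What remains is that the integral, defined as a difference of values of some
    antiderivative, is linear and monotone ([diamond_integral_le]). This rests
    on two facts.

    - A function with a nonnegative Delta-derivative on [a, b]_T does not
      decrease from a to b ([delta_derive_ge0_le]). Applied to a linear
      combination of antiderivatives, this yields linearity and monotonicity at
      once, and also that the choice of antiderivative is irrelevant.

    - A continuous function f has a Delta-antiderivative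
      ([delta_antiderivative_exists]). It is the Lebesgue integral of the step
      extension x |-> f(last point of [a, b]_T that is <= x): on a gap
      (t, sigma t) the extension is constantly f(t), which is what the
      Delta-derivative at t asks for, and on a side where t is a limit of points
      of T it tends to f(t).

    The nabla half of both facts follows by the reflection t |-> - t, which
    exchanges sigma and rho. *)

(** * Neighborhoods within a set, and closure *)

Lemma near_withinP (R : realType) (T P : set R) (t : R) :
  (\forall s \near within T (nbhs t), P s) <->
  exists2 d : R, 0 < d & forall s, T s -> `|s - t| < d -> P s.
Proof.
rewrite /within /=; split.
  move=> /nbhs_ballP[d /= d0 H]; exists d => // s Ts std.
  by apply: H => //; rewrite -ball_normE /ball_ /= distrC.
move=> [d d0 H]; apply/nbhs_ballP; exists d => //= s.
by rewrite -ball_normE /ball_ /= distrC => std Ts; exact: H.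
Qed.

Lemma within_continuousP (R : realType) (K : set R) (f : R -> R) :
  {within K, continuous f} <->
  forall t, K t -> forall e, 0 < e ->
    exists2 d : R, 0 < d & forall s, K s -> `|s - t| < d -> `|f s - f t| < e.
Proof.
split.
  move=> /subspace_continuousP cf t Kt e e0.
  have /cvgrPdist_lt/(_ _ e0)/near_withinP[d d0 H] := cf _ Kt.
  by exists d => // s Ks std; rewrite distrC; exact: H.
move=> H; apply/subspace_continuousP => t Kt.
apply/cvgrPdist_lt => e e0; apply/near_withinP.
have [d d0 {}H] := H _ Kt _ e0.
by exists d => // s Ks std; rewrite distrC; exact: H.
Qed.

Lemma closure_inf (R : realType) (A : set R) :
  A !=set0 -> has_lbound A -> closure A (inf A).
Proof.
move=> A0 Alb B /nbhs_ballP[e /= e0 eB].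
have [x Ax xlt] := inf_adherent e0 (conj A0 Alb : has_inf A).
exists x; split => //; apply: eB; rewrite -ball_normE /ball_ /=.
have := ge_inf Alb Ax; rewrite ltr_norml; lra.
Qed.

(** * The forward jump *)

Lemma sigma_ge (R : realType) (T : set R) (t : R) : t <= sigma T t.
Proof.
rewrite /sigma; case: ifPn => // /set0P U0.
by apply: lb_le_inf => // s [_ /ltW].
Qed.

Lemma sigma_le (R : realType) (T : set R) (t s : R) :
  T s -> t < s -> sigma T t <= s.
Proof.
move=> Ts ts; rewrite /sigma; case: ifPn => [/eqP U0|_].
  by have : [set s | T s /\ t < s] s by []; rewrite U0.
by apply: ge_inf => //; exists t => u [_ /ltW].
Qed.

Lemma sigma_in (R : realType) (T : set R) (t : R) :
  closed T -> T t -> T (sigma T t).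
Proof.
move=> cT Tt; rewrite /sigma; case: ifPn => // /set0P U0.
apply: cT; apply: (closure_subset (A := [set s | T s /\ t < s])).
  by move=> s [].
apply: closure_inf => //.
by exists t => s [_ /ltW].
Qed.

Lemma sigma_dense (R : realType) (T : set R) (t b : R) :
  T b -> t < b -> sigma T t = t ->
  forall d, 0 < d -> exists s, [/\ T s, t < s & s < t + d].
Proof.
move=> Tb tb st d d0.
have U0 : [set s | T s /\ t < s] !=set0 by exists b.
move: st; rewrite /sigma; case: ifPn => [/eqP U0'|_ st].
  by move: U0; rewrite U0' => -[].
have /(inf_adherent d0) : has_inf [set s | T s /\ t < s].
  by split => //; exists t => s [_ /ltW].
by rewrite st => -[s [Ts ts] sd]; exists s.
Qed.

(** * The Delta-derivative *)

Lemma is_delta_deriveP (R : realType) (T : set R) (F : R -> R) (t d : R) :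
  is_delta_derive T F t d <->
  forall e, 0 < e -> exists2 r : R, 0 < r & forall s, T s -> `|s - t| < r ->
    `|F (sigma T t) - F s - d * (sigma T t - s)| <= e * `|sigma T t - s|.
Proof.
by split=> H e e0; [have /near_withinP := H e e0 | apply/near_withinP/H].
Qed.

Lemma is_delta_derive_lin (R : realType) (T : set R) (F G : R -> R)
    (t d1 d2 c1 c2 : R) :
  is_delta_derive T F t d1 -> is_delta_derive T G t d2 ->
  is_delta_derive T (fun x => c1 * F x + c2 * G x) t (c1 * d1 + c2 * d2).
Proof.
move=> /is_delta_deriveP HF /is_delta_deriveP HG; apply/is_delta_deriveP => e e0.
pose C := `|c1| + `|c2| + 1.
have C0 : 0 < C by rewrite /C; have := normr_ge0 c1; have := normr_ge0 c2; lra.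
have eC0 : 0 < e / C by rewrite divr_gt0.
have [r1 r10 H1] := HF _ eC0; have [r2 r20 H2] := HG _ eC0.
exists (Num.min r1 r2) => [|s Ts]; first by rewrite lt_min r10.
rewrite lt_min => /andP[/(H1 _ Ts) {}H1 /(H2 _ Ts) {}H2].
set m := sigma T t in H1 H2 *.
rewrite (_ : _ - _ - _ = c1 * (F m - F s - d1 * (m - s))
  + c2 * (G m - G s - d2 * (m - s))); last by ring.
apply: le_trans (ler_normD _ _) _; rewrite !normrM.
apply: le_trans (lerD (ler_wpM2l (normr_ge0 _) H1)
  (ler_wpM2l (normr_ge0 _) H2)) _.
rewrite -mulrDl !mulrA ler_wpM2r//.
rewrite ler_pdivrMr// mulrC ler_wpM2l ?(ltW e0)// /C; lra.
Qed.

(** Compare the derivative estimate at s with the one at t itself: both approximate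
    F (sigma t), so F s - F t is controlled even when t is right-scattered. *)
Lemma delta_derive_continuous (R : realType) (T : set R) (F : R -> R)
    (t d : R) : T t -> is_delta_derive T F t d ->
  forall e, 0 < e ->
    exists2 r : R, 0 < r & forall s, T s -> `|s - t| < r -> `|F s - F t| < e.
Proof.
move=> Tt /is_delta_deriveP HF e e0.
set m := sigma T t in HF *; have tm : t <= m by exact: sigma_ge.
(* For |s - t| < 1, the two error terms add up to at most C times their factor. *)
pose C := 2 * (m - t) + 2.
have C0 : 0 < C by rewrite /C; lra.
pose D := `|d| + 1; have D0 : 0 < D by rewrite /D; have := normr_ge0 d; lra.
have e'0 : 0 < e / 2 / C by rewrite !divr_gt0.
have [r r0 H] := HF _ e'0.
have Ht : `|F m - F t - d * (m - t)| <= e / 2 / C * `|m - t|.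
  by apply: H => //; rewrite subrr normr0.
exists (Num.min r (Num.min 1 (e / 2 / D))) => [|s Ts].
  by rewrite !lt_min r0 ltr01 !divr_gt0.
rewrite !lt_min => /and3P[/(H _ Ts) Hs st1 stD].
have ms : `|m - s| <= m - t + `|s - t|.
  rewrite (_ : m - s = (m - t) + (t - s)); last by ring.
  by apply: le_trans (ler_normD _ _) _; rewrite (distrC t) ger0_norm ?subr_ge0.
rewrite (_ : F s - F t = (F m - F t - d * (m - t)) - (F m - F s - d * (m - s))
  + d * (s - t)); last by ring.
apply: le_lt_trans (ler_normD _ _) _.
have h1 : `|(F m - F t - d * (m - t)) - (F m - F s - d * (m - s))| <= e / 2.
  apply: le_trans (ler_normB _ _) _.
  apply: le_trans (lerD Ht Hs) _.
  rewrite -mulrDr -[leRHS](divfK (lt0r_neq0 C0)) ler_wpM2l ?(ltW e'0)//.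
  rewrite (ger0_norm (_ : 0 <= m - t)) ?subr_ge0// /C; lra.
have h2 : `|d * (s - t)| < e / 2.
  rewrite normrM; move: stD; rewrite ltr_pdivlMr// mulrC; apply: le_lt_trans.
  by rewrite ler_wpM2r// /D lerDl.
lra.
Qed.

(** For each e > 0, let A be the set of the t such that F a <= F t + e (t - a), and
    c its supremum. By continuity c is in A. If c < b, the derivative estimate at c
    puts in A a point beyond c: sigma c if c is right-scattered, and any close
    enough point on the right if c is right-dense. Hence c = b. *)
Lemma delta_derive_ge0_le (R : realType) (T : set R) (F D : R -> R) (a b : R) :
  closed T -> T a -> T b -> a <= b ->
  delta_antiderivative T a b D F ->
  (forall t, ts_itv T a b t -> 0 <= D t) ->
  F a <= F b.
Proof.
move=> cT Ta Tb ab FD D0.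
suff H e : 0 < e -> F a <= F b + e * (b - a).
  apply/ler_addgt0Pr => e e0.
  have C0 : 0 < b - a + 1 by lra.
  apply: le_trans (H (e / (b - a + 1)) _) _; first by rewrite divr_gt0.
  by rewrite lerD2l mulrAC ler_pdivrMr// ler_wpM2l ?(ltW e0)//; lra.
move=> e0.
pose A := [set t | ts_itv T a b t /\ F a <= F t + e * (t - a)].
have Aa : A a by rewrite /A /ts_itv /= lexx ab subrr mulr0 addr0.
have A0 : A !=set0 by exists a.
have Aub : has_ubound A by exists b => t [[/andP[]]].
pose c := sup A.
have ac : a <= c by exact: ub_le_sup.
have cb : c <= b by apply: ge_sup => // t [[/andP[]]].
have Tc : T c.
  by apply: cT; apply: (closure_subset _ (closure_sup A0 Aub)) => t [[]].
have Kc : ts_itv T a b c by split => //=; rewrite ac.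
have Pc : F a <= F c + e * (c - a).
  apply/ler_addgt0Pr => n n0.
  have [r r0 H] := delta_derive_continuous Tc (FD _ Kc) n0.
  have [s As cs] := sup_adherent r0 (conj A0 Aub).
  have sc : s <= c by exact: ub_le_sup.
  have [[_ Ts] Ps] := As.
  have : `|F s - F c| < n.
    by apply: H => //; rewrite -/c in cs; rewrite ltr_norml; lra.
  rewrite ltr_norml => /andP[_ h].
  have : e * (s - a) <= e * (c - a) by rewrite ler_wpM2l ?(ltW e0)// lerD2r.
  lra.
suff : ~~ (c < b).
  by rewrite -leNgt => bc; rewrite -(le_anti (introT andP (conj cb bc))).
apply/negP => cltb.
have cm := sigma_ge T c; have mb := sigma_le Tb cltb.
have Tm := sigma_in cT Tc.
have /is_delta_deriveP/(_ _ e0)[r r0 H] := FD _ Kc.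
have Dc := D0 _ Kc.
have [s [As cs]] : exists s, A s /\ c < s.
  move: cm; rewrite le_eqVlt => /predU1P[/esym mc|cm].
    have [|s [Ts cs sr]] := sigma_dense Tb cltb mc (d := Num.min r (b - c)).
      by rewrite lt_min r0 subr_gt0.
    move: sr; rewrite -ltrBlDl lt_min => /andP[sr sb].
    exists s; split => //; split.
      by split => //=; apply/andP; split; lra.
    have := H s Ts; rewrite mc ger0_norm; last lra.
    move=> /(_ sr); rewrite (distrC c s) (ger0_norm (_ : 0 <= s - c)); last lra.
    rewrite ler_norml => /andP[_ h].
    have : 0 <= D c * (s - c) by rewrite mulr_ge0//; lra.
    move: h; lra.
  exists (sigma T c); split => //; split.
    by split => //=; apply/andP; split => //; exact: le_trans (ltW cm).
  have := H c Tc; rewrite subrr normr0 => /(_ r0).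
  rewrite (ger0_norm (_ : 0 <= sigma T c - c)); last lra.
  rewrite ler_norml => /andP[h _].
  have : 0 <= D c * (sigma T c - c) by rewrite mulr_ge0//; lra.
  move: h; lra.
have := ub_le_sup Aub As; rewrite -/c; lra.
Qed.

(** * Existence of Delta-antiderivatives *)

Lemma compact_ts_itv (R : realType) (T : set R) (a b : R) :
  closed T -> compact (ts_itv T a b).
Proof.
move=> cT; rewrite /ts_itv (_ : [set t | _] = `[a, b]%classic).
  by apply: compact_closedI => //; exact: segment_compact.
by rewrite set_itvcc.
Qed.

(** The last point of [a, b]_T that is at most x. Replacing x by the maximum of
    a and x makes the set nonempty for all x, so that f \o ts_floor T a b continues
    f by the constant f a on the left of a, as it does by f b on the right of b.
    This takes care of the conditions that the derivatives at a and b impose on an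
    antiderivative outside [a, b]. *)
Definition ts_floor (R : realType) (T : set R) (a b x : R) : R :=
  sup [set s | ts_itv T a b s /\ s <= Num.max a x].

Section ts_floor.
Variables (R : realType) (T : set R) (a b : R).
Hypotheses (cT : closed T) (Ta : T a) (ab : a <= b).

Let below x := [set s | ts_itv T a b s /\ s <= Num.max a x].

Let below0 x : below x !=set0.
Proof. by exists a; rewrite /below /ts_itv /= lexx ab le_max lexx. Qed.

Let below_ub x : has_ubound (below x).
Proof. by exists b => s [[/andP[]]]. Qed.

Lemma ts_floor_ge x s : ts_itv T a b s -> s <= Num.max a x ->
  s <= ts_floor T a b x.
Proof. by move=> Ks sx; apply: (ub_le_sup (below_ub x)). Qed.

Lemma ts_floor_le x y :
  (forall s, ts_itv T a b s -> s <= Num.max a x -> s <= y) ->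
  ts_floor T a b x <= y.
Proof. by move=> H; apply: (ge_sup (below0 x)) => s []; exact: H. Qed.

Lemma ts_floor_in x : ts_itv T a b (ts_floor T a b x).
Proof.
have K : closed (ts_itv T a b).
  by apply: compact_closed; [exact: Rhausdorff|exact: compact_ts_itv].
apply: K; apply: (closure_subset _ (closure_sup (below0 x) (below_ub x))).
by move=> s [].
Qed.

Lemma ts_floor_homo : {homo ts_floor T a b : x y / x <= y}.
Proof.
move=> x y xy; apply: ts_floor_le => s Ks sx; apply: ts_floor_ge => //.
by apply: le_trans sx _; rewrite ge_max !le_max lexx xy orbT.
Qed.

(** For x in a gap after t the rounding is exactly t, and for x between t and s it
    falls between t and s; x can be nowhere else when it lies between s and
    sigma t. *)
Lemma ts_floor_near t s x : ts_itv T a b t -> T s ->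
  Num.min s (sigma T t) <= x < Num.max s (sigma T t) ->
  `|ts_floor T a b x - t| <= `|s - t|.
Proof.
move=> Kt Ts /andP[lx xu]; have [/andP[at_ tb] Tt] := Kt.
have tm := sigma_ge T t.
have upper : ts_floor T a b x <= Num.max t s.
  apply: ts_floor_le => u [/andP[au ub] Tu] ux; rewrite le_max.
  case: (leP u t) => //= tu; have mu := sigma_le Tu tu.
  have {}ux : u <= x by move: ux; rewrite le_max; case/orP => // ua; lra.
  by move: xu; rewrite lt_max; case/orP => ?; lra.
have lower : Num.min t s <= ts_floor T a b x.
  rewrite ge_min; case: (leP t x) => [tx|xt].
    by rewrite ts_floor_ge// le_max tx orbT.
  have sx : s <= x by move: lx; rewrite ge_min; case/orP => //; lra.
  apply/orP; right; case: (leP a s) => [as_|sa].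
    rewrite ts_floor_ge ?le_max ?sx ?orbT//.
    by split => //=; apply/andP; split => //; lra.
  apply: le_trans (ltW sa) _; apply: ts_floor_ge; last by rewrite le_max lexx.
  by split => //=; rewrite lexx ab.
move: upper lower; rewrite le_max ge_min ler_norml.
case: (ger0P (s - t)) => st /orP[] u1 /orP[] u2; apply/andP; split; lra.
Qed.

End ts_floor.

Section comp_floor.
Variables (R : realType) (T : set R) (a b : R) (f : R -> R).
Hypotheses (cT : closed T) (Ta : T a) (ab : a <= b).
Hypothesis cf : {within ts_itv T a b, continuous f}.

Lemma integrable_comp_ts_floor (l u : R) :
  lebesgue_measure.-integrable `[l, u] (EFin \o (f \o ts_floor T a b)).
Proof.
have cK := @compact_ts_itv R T a b cT.
have mK := compact_measurable cK.
apply: measurable_bounded_integrable => //.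
- by rewrite /= lebesgue_measure_itv /=; case: ifPn => // _; rewrite -EFinB ltry.
- apply: (measurable_comp mK).
  + by move=> _ [x _ <-]; exact: ts_floor_in.
  + exact: subspace_continuous_measurable_fun.
  + by apply: nondecreasing_measurable => // x y; exact: ts_floor_homo.
- have [M [Mr HM]] := compact_bounded (continuous_compact cf cK).
  exists M; split => // x Mx y _ /=; apply: HM => //.
  by exists (ts_floor T a b y) => //; exact: ts_floor_in.
Qed.

End comp_floor.

(** The bound on h is asked for on the half-open interval because, at the right end
    of a gap, the step extension has already jumped to its next value. *)
Lemma Rintegral_itv_dist_le (R : realType) (h : R -> R) (l x y c e : R) :
  (forall u v : R, lebesgue_measure.-integrable `[u, v] (EFin \o h)) ->
  l <= x -> x <= y -> (forall z, x <= z < y -> `|h z - c| <= e) ->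
  `|\int[lebesgue_measure]_(z in `[l, y]) h z
    - \int[lebesgue_measure]_(z in `[l, x]) h z - c * (y - x)| <= e * (y - x).
Proof.
move=> ih lx xy H.
have lI u v : lebesgue_measure.-integrable `]u, v[ (EFin \o h).
  by apply: integrableS (ih u v) => //; exact: subset_itv_oo_cc.
have lc r : lebesgue_measure.-integrable `]x, y[ (EFin \o cst r).
  suff : lebesgue_measure.-integrable `[x, y] (EFin \o cst r).
    by apply: integrableS => //; exact: subset_itv_oo_cc.
  apply: continuous_compact_integrable; first exact: segment_compact.
  by move=> ?; exact: cvg_cst.
have mu r : \int[lebesgue_measure]_(z in `]x, y[) (cst r z) = r * (y - x).
  rewrite Rintegral_cst//= lebesgue_measure_itv /= lte_fin.
  by move: xy; rewrite le_eqVlt => /predU1P[->|xy]; rewrite ?ltxx ?subrr// xy.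
rewrite Rintegral_itvB ?bnd_simp//.
rewrite -Rintegral_itv_bndo_bndc; last exact: lI.
rewrite -mu -RintegralB//.
apply: le_trans (le_normr_Rintegral _ _) _ => //.
  exact: (integrableB _ (lI _ _) (lc _)).
rewrite -mu; apply: le_Rintegral => //.
  exact: (integrable_norm (integrableB _ (lI _ _) (lc _))).
by move=> z /=; rewrite in_itv /= => /andP[xz zy]; apply: H; rewrite ltW.
Qed.

Lemma delta_antiderivative_exists (R : realType) (T : set R) (a b : R)
    (f : R -> R) : closed T -> T a -> a <= b ->
  {within ts_itv T a b, continuous f} ->
  exists F, delta_antiderivative T a b f F.
Proof.
move=> cT Ta ab cf.
pose h := f \o ts_floor T a b.
(* The base point a - 1 lets F be evaluated slightly to the left of a. *)
pose F t := \int[lebesgue_measure]_(x in `[a - 1, t]) h x.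
exists F => t Kt; apply/is_delta_deriveP => e e0.
have [/andP[at_ tb] Tt] := Kt.
have [r r0 Hr] := (within_continuousP _ _).1 cf _ Kt _ e0.
exists (Num.min r 1) => [|s Ts]; first by rewrite lt_min r0 ltr01.
rewrite lt_min => /andP[sr s1].
have hE x : Num.min s (sigma T t) <= x < Num.max s (sigma T t) ->
    `|h x - f t| <= e.
  move=> /(ts_floor_near Ta ab Kt Ts) near_t.
  by apply/ltW/Hr; [exact: ts_floor_in | exact: le_lt_trans near_t sr].
have tm := sigma_ge T t.
have sa : a - 1 <= s by move: s1; rewrite ltr_norml => /andP[]; lra.
have ih := integrable_comp_ts_floor cT Ta ab cf.
case: (leP s (sigma T t)) hE => [sm|/ltW ms] hE.
  by rewrite (ger0_norm (_ : 0 <= sigma T t - s)) ?subr_ge0//;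
     apply: Rintegral_itv_dist_le.
rewrite (_ : _ - _ - _ = - (F s - F (sigma T t) - f t * (s - sigma T t))).
  rewrite normrN (distrC _ s) (ger0_norm (_ : 0 <= s - sigma T t)) ?subr_ge0//.
  by apply: Rintegral_itv_dist_le => //; lra.
by ring.
Qed.

(** * Reflection: from Delta to nabla *)

Definition mirror (R : realType) (T : set R) : set R := [set s | T (- s)].

Lemma closed_mirror (R : realType) (T : set R) : closed T -> closed (mirror T).
Proof.
move=> cT; apply: (@closed_comp _ _ (-%R : R -> R)) => // x _.
exact: opp_continuous.
Qed.

Lemma ts_itv_mirror (R : realType) (T : set R) (a b t : R) :
  ts_itv (mirror T) (- b) (- a) t <-> ts_itv T a b (- t).
Proof.
by rewrite /ts_itv /mirror /= lerNl lerNr andbC.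
Qed.

Lemma sigma_mirror (R : realType) (T : set R) (t : R) :
  sigma (mirror T) (- t) = - rho T t.
Proof.
rewrite /sigma /rho.
have UE : -%R @` [set s | mirror T s /\ - t < s] = [set s | T s /\ s < t].
  apply/seteqP; split => s /=.
    by move=> [u [Tu tu] <-]; split => //; rewrite ltrNl.
  by move=> [Ts st]; exists (- s); rewrite ?opprK//; split;
    rewrite /mirror/= ?opprK ?ltrN2.
rewrite /inf UE -UE; set U := [set s | _].
have -> : (-%R @` U == set0) = (U == set0).
  by apply/eqP/eqP => [/image_set0_set0//|->]; rewrite image_set0.
by case: ifP.
Qed.

Lemma nabla_derive_mirror (R : realType) (T : set R) (H : R -> R) (t d : R) :
  is_nabla_derive T H t d <->
  is_delta_derive (mirror T) (fun x => - H (- x)) (- t) d.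
Proof.
rewrite /is_nabla_derive /is_delta_derive sigma_mirror.
have E s e :
  (`|- H (- - rho T t) - - H (- s) - d * (- rho T t - s)| <= e * `|- rho T t - s|)
  = (`|H (rho T t) - H (- s) - d * (rho T t - - s)| <= e * `|rho T t - - s|).
  rewrite -[in RHS]normrN -[in RHS](normrN (rho T t - - s)) opprK.
  have -> : - (rho T t - - s) = - rho T t - s by ring.
  by have -> : - (H (rho T t) - H (- s) - d * (rho T t - - s)) =
    - H (rho T t) - - H (- s) - d * (- rho T t - s) by ring.
split=> HH e e0; have /near_withinP[r r0 Hr] := HH e e0;
    apply/near_withinP; exists r => // s Ts sr.
  rewrite E; apply: Hr => //.
  by move: sr; rewrite opprK -normrN opprD.
have := Hr (- s); rewrite E /mirror/= opprK; apply => //.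
by rewrite -normrN opprD !opprK.
Qed.

Lemma nabla_antiderivative_mirror (R : realType) (T : set R) (a b : R)
    (f H : R -> R) :
  nabla_antiderivative T a b f H <->
  delta_antiderivative (mirror T) (- b) (- a) (f \o -%R) (fun x => - H (- x)).
Proof.
split=> HH t.
  move=> /ts_itv_mirror /HH /nabla_derive_mirror; by rewrite opprK.
move=> Kt; apply/nabla_derive_mirror; have := HH (- t).
by rewrite /= opprK; apply; apply/ts_itv_mirror; rewrite opprK.
Qed.

Lemma nabla_antiderivative_exists (R : realType) (T : set R) (a b : R)
    (f : R -> R) : closed T -> T b -> a <= b ->
  {within ts_itv T a b, continuous f} ->
  exists H, nabla_antiderivative T a b f H.
Proof.
move=> cT Tb ab cf.
have [||||F HF] := @delta_antiderivative_exists R (mirror T) (- b) (- a)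
  (f \o -%R).
- exact: closed_mirror.
- by rewrite /mirror/= opprK.
- by rewrite lerN2.
- apply/within_continuousP => t /ts_itv_mirror Kt e e0.
  have [r r0 H] := (within_continuousP _ _).1 cf _ Kt _ e0.
  exists r => // s /ts_itv_mirror Ks sr /=; apply: H => //.
  by rewrite -normrN opprD !opprK.
exists (fun t => - F (- t)); apply/nabla_antiderivative_mirror.
by rewrite (_ : (fun x => _) = F)//; apply/funext => x; rewrite !opprK.
Qed.

(** * Linearity and monotonicity of the integrals *)

Lemma delta_antiderivative_le (R : realType) (T : set R) (a b c1 c2 : R)
    (f f1 f2 F F1 F2 : R -> R) : closed T -> T a -> T b -> a <= b ->
  delta_antiderivative T a b f F ->
  delta_antiderivative T a b f1 F1 ->
  delta_antiderivative T a b f2 F2 ->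
  (forall t, ts_itv T a b t -> f t <= c1 * f1 t + c2 * f2 t) ->
  F b - F a <= c1 * (F1 b - F1 a) + c2 * (F2 b - F2 a).
Proof.
move=> cT Ta Tb ab HF HF1 HF2 le_f.
pose D x := 1 * (c1 * f1 x + c2 * f2 x) + (-1) * f x.
pose G x := 1 * (c1 * F1 x + c2 * F2 x) + (-1) * F x.
have : G a <= G b.
  apply: (@delta_derive_ge0_le R T G D a b) => // t Kt.
    apply: is_delta_derive_lin; last exact: HF.
    by apply: is_delta_derive_lin; [exact: HF1|exact: HF2].
  by have := le_f _ Kt; rewrite /D; lra.
by rewrite /G; lra.
Qed.

Lemma nabla_antiderivative_le (R : realType) (T : set R) (a b c1 c2 : R)
    (f f1 f2 F F1 F2 : R -> R) : closed T -> T a -> T b -> a <= b ->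
  nabla_antiderivative T a b f F ->
  nabla_antiderivative T a b f1 F1 ->
  nabla_antiderivative T a b f2 F2 ->
  (forall t, ts_itv T a b t -> f t <= c1 * f1 t + c2 * f2 t) ->
  F b - F a <= c1 * (F1 b - F1 a) + c2 * (F2 b - F2 a).
Proof.
move=> cT Ta Tb ab /nabla_antiderivative_mirror HF
  /nabla_antiderivative_mirror HF1 /nabla_antiderivative_mirror HF2 le_f.
have := delta_antiderivative_le (closed_mirror cT) _ _ _ HF HF1 HF2.
move=> /(_ c1 c2); rewrite /mirror/= !opprK lerN2 => /(_ Tb Ta ab) H.
suff : forall t, ts_itv (mirror T) (- b) (- a) t ->
    f (- t) <= c1 * f1 (- t) + c2 * f2 (- t) by move=> /H; lra.
by move=> t /ts_itv_mirror; exact: le_f.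
Qed.

(** This single inequality expresses that the integral is monotone, additive and
    homogeneous, in the form in which a convexity bound is integrated. *)
Lemma diamond_integral_le (R : realType) (T : set R) (alpha a b c1 c2 : R)
    (f f1 f2 : R -> R) : closed T -> T a -> T b -> a <= b -> 0 <= alpha <= 1 ->
  {within ts_itv T a b, continuous f} ->
  {within ts_itv T a b, continuous f1} ->
  {within ts_itv T a b, continuous f2} ->
  (forall t, ts_itv T a b t -> f t <= c1 * f1 t + c2 * f2 t) ->
  diamond_integral T alpha a b f <=
  c1 * diamond_integral T alpha a b f1 + c2 * diamond_integral T alpha a b f2.
Proof.
move=> cT Ta Tb ab /andP[al0 al1] cf cf1 cf2 le_f.
have dP h (ch : {within ts_itv T a b, continuous h}) :=
  xgetPex (fun=> 0) (delta_antiderivative_exists cT Ta ab ch).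
have nP h (ch : {within ts_itv T a b, continuous h}) :=
  xgetPex (fun=> 0) (nabla_antiderivative_exists cT Tb ab ch).
have D := delta_antiderivative_le cT Ta Tb ab (dP _ cf) (dP _ cf1) (dP _ cf2)
  le_f.
have N := nabla_antiderivative_le cT Ta Tb ab (nP _ cf) (nP _ cf1) (nP _ cf2)
  le_f.
have al1' : 0 <= 1 - alpha by rewrite subr_ge0.
have := lerD (ler_wpM2l al0 D) (ler_wpM2l al1' N).
rewrite /diamond_integral /delta_integral /nabla_integral; lra.
Qed.

Lemma diamond_integral_ge0 (R : realType) (T : set R) (alpha a b : R)
    (f : R -> R) : closed T -> T a -> T b -> a <= b -> 0 <= alpha <= 1 ->
  {within ts_itv T a b, continuous f} ->
  (forall t, ts_itv T a b t -> 0 <= f t) ->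
  0 <= diamond_integral T alpha a b f.
Proof.
move=> cT Ta Tb ab al cf f0.
(* Integrating f <= 2 f gives I <= 2 I. *)
have := @diamond_integral_le R T alpha a b 2 0 f f f cT Ta Tb ab al cf cf cf.
set I := diamond_integral _ _ _ _ _ => H.
suff /H : forall t, ts_itv T a b t -> f t <= 2 * f t + 0 * f t by lra.
by move=> t /f0; lra.
Qed.

(** * Minkowski's inequality *)

Lemma continuous_norm_powR (R : realType) (p : R) : 0 < p ->
  continuous (fun y : R => `|y| `^ p).
Proof.
move=> p0 y; have [->|y0] := eqVneq y 0; last first.
  apply: (@continuous_comp _ _ _ (fun y : R => `|y|) (@powR R ^~ p)).
    exact: norm_continuous.
  apply: differentiable_continuous; apply/derivable1_diffP.
  by apply: derivable_powR; rewrite in_itv/= andbT normr_gt0.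
apply/cvgrPdist_lt => e e0; rewrite normr0 powR0 ?gt_eqF//.
apply/nbhs_ballP; exists (e `^ p^-1) => [|z] /=; first exact: powR_gt0.
rewrite /ball /= !sub0r !normrN => ze.
rewrite ger0_norm ?powR_ge0//.
have -> : e = (e `^ p^-1) `^ p by rewrite -powRrM mulVf ?gt_eqF// powRr1// ltW.
by apply: gt0_ltr_powR => //; rewrite ?nnegrE ?powR_ge0.
Qed.

Lemma continuous_within_norm_powR (R : realType) (p : R) (K : set R)
    (h : R -> R) : 0 < p ->
  {within K, continuous h} -> {within K, continuous (fun x => `|h x| `^ p)}.
Proof.
move=> p0 ch x.
have hp := @continuous_norm_powR R p p0 (h x).
exact: (@continuous_comp (subspace K) R R h (fun y : R => `|y| `^ p) x (ch x) hp).
Qed.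

(** Convexity of the p-th power, for the weights A / (A + B) and B / (A + B) and the
    points |x| / A and |y| / B. *)
Lemma powR_normD_le (R : realType) (p A B x y : R) : 1 <= p -> 0 < A -> 0 < B ->
  `|x + y| `^ p <=
  (A + B) `^ p * (A / (A + B) / A `^ p) * `|x| `^ p
  + (A + B) `^ p * (B / (A + B) / B `^ p) * `|y| `^ p.
Proof.
move=> p1 A0 B0; have p0 : 0 <= p by rewrite (le_trans _ p1).
have S0 : 0 < A + B by rewrite addr_gt0.
have x0 : 0 <= `|x| / A by rewrite divr_ge0// ltW.
have y0 : 0 <= `|y| / B by rewrite divr_ge0// ltW.
pose l := A / (A + B).
have lE : 1 - l = B / (A + B) by rewrite /l; field; rewrite gt_eqF.
have l0 : 0 <= l by rewrite divr_ge0// ltW.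
have l1 : l <= 1 by rewrite -subr_ge0 lE divr_ge0// ltW.
have cvx : (l * (`|x| / A) + (1 - l) * (`|y| / B)) `^ p <=
    l * (`|x| / A) `^ p + (1 - l) * (`|y| / B) `^ p.
  by apply: (convex_powR p1 (Itv01 l0 l1)); rewrite ?inE/= ?in_itv/= ?andbT.
apply: (@le_trans _ _ ((A + B) `^ p *
    (l * (`|x| / A) + (1 - l) * (`|y| / B)) `^ p)).
  rewrite -powRM ?(ltW S0)//; last first.
    by rewrite addr_ge0// mulr_ge0// subr_ge0.
  rewrite ge0_ler_powR ?nnegrE//.
    by rewrite mulr_ge0 ?(ltW S0)// addr_ge0// mulr_ge0// subr_ge0.
  apply: le_trans (ler_normD _ _) _; rewrite lE /l le_eqVlt; apply/orP; left.
  by apply/eqP; field; rewrite !gt_eqF.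
have powV u C : 0 < C -> (`|u| / C) `^ p = `|u| `^ p / C `^ p.
  move=> C0; apply: (canRL (mulfK _)); first by rewrite gt_eqF// powR_gt0.
  by rewrite -powRM ?divr_ge0 ?(ltW C0)// divfK// gt_eqF.
apply: le_trans (ler_wpM2l (powR_ge0 _ _) cvx) _.
rewrite !powV// lE /l le_eqVlt; apply/orP; left; apply/eqP; ring.
Qed.

(** Here X, Y and Z are the integrals of |f|^p, |g|^p and |f + g|^p. The best choice
    A = X^(1/p), B = Y^(1/p) turns the bound into Z <= (A + B)^p. As these
    may be 0, both are increased by e / 2, and e is arbitrary. *)
Lemma minkowski_of_weights (R : realType) (p X Y Z : R) : 0 < p ->
  0 <= X -> 0 <= Y -> 0 <= Z ->
  (forall A B, 0 < A -> 0 < B ->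
    Z <= (A + B) `^ p * (A / (A + B) / A `^ p) * X
       + (A + B) `^ p * (B / (A + B) / B `^ p) * Y) ->
  Z `^ (1 / p) <= X `^ (1 / p) + Y `^ (1 / p).
Proof.
move=> p0 X0 Y0 Z0 H.
have powK z : 0 <= z -> (z `^ (1 / p)) `^ p = z.
  by move=> z0; rewrite -powRrM div1r mulVf ?gt_eqF// powRr1.
set A := X `^ (1 / p); set B := Y `^ (1 / p).
have A0 : 0 <= A by exact: powR_ge0.
have B0 : 0 <= B by exact: powR_ge0.
apply/ler_addgt0Pr => e e0.
pose A' := A + e / 2; pose B' := B + e / 2.
have A'0 : 0 < A' by rewrite /A'; lra.
have B'0 : 0 < B' by rewrite /B'; lra.
have S'0 : 0 < A' + B' by lra.
have ZS : Z <= (A' + B') `^ p.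
  apply: le_trans (H _ _ A'0 B'0) _.
  rewrite -(powK _ X0) -(powK _ Y0) -/A -/B.
  have ratio u v w : 0 <= u -> u <= v -> 0 < v -> 0 <= w ->
      (A' + B') `^ p * (w / v `^ p) * u `^ p <= (A' + B') `^ p * w.
    move=> u0 uv v0 w0; rewrite -mulrA ler_wpM2l ?powR_ge0//.
    rewrite mulrAC ler_pdivrMr ?powR_gt0// ler_wpM2l//.
    by rewrite ge0_ler_powR ?nnegrE ?(ltW p0)// ltW.
  apply: le_trans (lerD (ratio A A' _ A0 _ A'0 _) (ratio B B' _ B0 _ B'0 _)) _.
  - by rewrite /A'; lra.
  - by rewrite divr_ge0// ltW.
  - by rewrite /B'; lra.
  - by rewrite divr_ge0// ltW.
  - by rewrite -mulrDr -mulrDl divff ?gt_eqF// mulr1.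
have -> : A + B + e = A' + B' by rewrite /A' /B'; lra.
have -> : A' + B' = ((A' + B') `^ p) `^ (1 / p).
  by rewrite -powRrM div1r mulfV ?gt_eqF// powRr1// ltW.
by rewrite ge0_ler_powR ?nnegrE ?powR_ge0// divr_ge0// ltW.
Qed.

Theorem theorem123 (R : realType) (T : set R) (hT : time_scale T)
    (a b : R) (ha : T a) (hb : T b) (hab : a < b)
    (alpha : R) (halpha : 0 <= alpha <= 1) (p : R) (hp : 1 < p)
    (f g : R -> R)
    (hf : {within ts_itv T a b, continuous f})
    (hg : {within ts_itv T a b, continuous g}) :
  diamond_integral T alpha a b (fun x => `|f x + g x| `^ p) `^ (1 / p) <=
  diamond_integral T alpha a b (fun x => `|f x| `^ p) `^ (1 / p) +
  diamond_integral T alpha a b (fun x => `|g x| `^ p) `^ (1 / p).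
Proof.
have [_ cT] := hT; have p0 : 0 < p by exact: lt_trans hp.
have cpow (h : R -> R) (ch : {within ts_itv T a b, continuous h}) :=
  continuous_within_norm_powR p0 ch.
have hfg : {within ts_itv T a b, continuous (fun x => f x + g x)}.
  by move=> x; apply: continuousD; [exact: hf|exact: hg].
have I_ge0 (h : R -> R) : {within ts_itv T a b, continuous h} ->
    0 <= diamond_integral T alpha a b (fun x => `|h x| `^ p).
  move=> ch; exact: (diamond_integral_ge0 cT ha hb (ltW hab) halpha
    (cpow _ ch) (fun t _ => powR_ge0 _ _)).
apply: (minkowski_of_weights p0 (I_ge0 _ hf) (I_ge0 _ hg) (I_ge0 _ hfg)).
move=> A B A0 B0.
exact: (diamond_integral_le cT ha hb (ltW hab) halpha (cpow _ hfg)
  (cpow _ hf) (cpow _ hg) (fun t _ => powR_normD_le (f t) (g t) (ltW hp) A0 B0)).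
Qed.
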